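(* Let $\Omega\subset\mathbb{R}^n$ be a domain, let $R=\max_{x\in\overline{\Omega}}\operatorname{dist}(x,\Omega^c)$, and let $\lambda_{1,\infty}(\Omega)$ denote the principal eigenvalue $\lambda_1(\Omega)$ of $-L$ for the homogeneous infinity laplacian $$Lu=\Delta_\infty^H u=\left(\frac{\nabla u}{|\nabla u|}\right)^t D^2u\,\frac{\nabla u}{|\nabla u|}.$$ Then $$\lambda_{1,\infty}(\Omega)=\left(\frac{\pi}{2R}\right)^2.$$
   Context: A domain is a nonempty connected open set; $\Omega^c=\mathbb{R}^n\setminus\Omega$ is assumed nonempty and the maximum defining $R$ is assumed to exist (in particular $R<\infty$). Let $S^{n\times n}$ be the set of real symmetric $n\times n$ matrices. Write $Lu=F(u,\nabla u,D^2u)$ with $F:\mathbb{R}\times(\mathbb{R}^n\setminus\{0\})\times S^{n\times n}\to\mathbb{R}$; for the homogeneous infinity laplacian, $F(s,q,Y)=|q|^{-2}\,q^tYq$. The lower semicontinuous envelope is $F_*(s,q,Y)=\liminf_{(r,p,X)\to(s,q,Y)}F(r,p,X)$, defined also for $q=0$. For a continuous $v:\Omega\to\mathbb{R}$, ''$Lv+\lambda v\le 0$ in $\Omega$ in the viscosity sense'' means that for every $x\in\Omega$ and every $\psi\in C^2$ that touches $v$ at $x$ strictly from below (i.e. $\psi(x)=v(x)$ and $\psi<v$ at all other points of a neighborhood of $x$), one has $F_*(\psi(x),\nabla\psi(x),D^2\psi(x))+\lambda\psi(x)\le 0$. Principal eigenvalue of $-L$: $$\lambda_1(\Omega)=\sup\{\lambda\in\mathbb{R}:\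 \exists\, v\in C(\Omega)\text{ with } v(x)>0\ \forall x\in\Omega\text{ and } Lv+\lambda v\le 0 \text{ in }\Omega\text{ in the viscosity sense}\}.$$ *)

(* Defs.v *)
(* R^n is the type of column vectors over an abstract R : realType. *)
From HB Require Import structures.
From mathcomp Require Import all_boot all_order all_algebra.
From mathcomp Require Import all_classical all_reals all_analysis.
Set Implicit Arguments.
Unset Strict Implicit.
Unset Printing Implicit Defensive.
Import Order.TTheory GRing.Theory Num.Theory.
Import numFieldNormedType.Exports.
Local Open Scope classical_set_scope.
Local Open Scope ring_scope.

(* The library norm `|x| on 'cV[R]_n is the sup norm; it induces the same
   topology, but distances and |q| must use the Euclidean norm. *)
Definition enorm (R : realType) (n : nat) (x : 'cV[R]_n) : R :=
  Num.sqrt (\sum_(i < n) x i ord0 ^+ 2).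

Definition edist_to (R : realType) (n : nat) (x : 'cV[R]_n)
    (A : set 'cV[R]_n) : R :=
  inf [set enorm (x - y) | y in A].

Definition is_domain (R : realType) (n : nat) (Omega : set 'cV[R]_n) : Prop :=
  [/\ Omega !=set0, open Omega & connected Omega].

(* r = max over closure(Omega) of dist(x, Omega^c); in particular the maximum
   is attained. *)
Definition is_inradius (R : realType) (n : nat) (Omega : set 'cV[R]_n)
    (r : R) : Prop :=
  let D := [set edist_to x (~` Omega) | x in closure Omega] in
  D r /\ ubound D r.

Definition ebasis (R : realType) (n : nat) (i : 'I_n) : 'cV[R]_n :=
  delta_mx i ord0.

Definition partial (R : realType) (n : nat) (i : 'I_n) (f : 'cV[R]_n -> R) :
    'cV[R]_n -> R :=
  fun x => derive f x (ebasis R i).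

Definition grad (R : realType) (n : nat) (f : 'cV[R]_n -> R) (x : 'cV[R]_n) :
    'cV[R]_n :=
  \col_i partial i f x.

Definition hessian (R : realType) (n : nat) (f : 'cV[R]_n -> R)
    (x : 'cV[R]_n) : 'M[R]_n :=
  \matrix_(i, j) partial i (partial j f) x.

(* To be used with U open, so that partial derivatives at points of U
   depend only on the values of f on U. *)
Definition C2_on (R : realType) (n : nat) (U : set 'cV[R]_n)
    (f : 'cV[R]_n -> R) : Prop :=
  forall x, U x ->
  [/\ {for x, continuous f},
      forall i, derivable f x (ebasis R i),
      forall i, {for x, continuous (partial i f)},
      forall i j, derivable (partial j f) x (ebasis R i) &
      forall i j, {for x, continuous (partial i (partial j f))}].

(* An operator Lu = F(u, grad u, D^2 u), with F defined for q <> 0 and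
   symmetric Y, is represented by a total function; everything below only
   depends on its values at such arguments. *)
Definition operator (R : realType) (n : nat) : Type :=
  R -> 'cV[R]_n -> 'M[R]_n -> R.

Definition operator_domain (R : realType) (n : nat) :
    set (R * 'cV[R]_n * 'M[R]_n) :=
  [set z | z.1.2 != 0 /\ z.2^T = z.2].

(* F_*(s, q, Y): liminf of F along (r, p, X) -> (s, q, Y) within the domain of
   F; the point (s, q, Y) itself is not excluded. Extended-real valued. *)
Definition lsc_envelope (R : realType) (n : nat) (F : operator R n)
    (s : R) (q : 'cV[R]_n) (Y : 'M[R]_n) : \bar R :=
  limf_einf (fun z : R * 'cV[R]_n * 'M[R]_n => (F z.1.1 z.1.2 z.2)%:E)
    (within (@operator_domain R n) (nbhs (s, q, Y))).

Definition touches_from_below (R : realType) (n : nat)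
    (psi v : 'cV[R]_n -> R) (x : 'cV[R]_n) : Prop :=
  psi x = v x /\ \forall y \near x^', psi y < v y.

(* L v + lam v <= 0 in Omega in the viscosity sense. Only the values of v on
   Omega matter when Omega is open. *)
Definition viscosity_supersolution (R : realType) (n : nat)
    (F : operator R n) (Omega : set 'cV[R]_n) (lam : R)
    (v : 'cV[R]_n -> R) : Prop :=
  forall (x : 'cV[R]_n) (psi : 'cV[R]_n -> R), Omega x ->
  (exists U : set 'cV[R]_n, [/\ open U, U x & C2_on U psi]) ->
  touches_from_below psi v x ->
  (lsc_envelope F (psi x) (grad psi x) (hessian psi x)
     + (lam * psi x)%:E <= 0)%E.

(* Principal eigenvalue of -L; the supremum is taken in the extended reals. *)
Definition lambda1 (R : realType) (n : nat) (F : operator R n)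
    (Omega : set 'cV[R]_n) : \bar R :=
  ereal_sup [set lam%:E | lam in [set lam : R |
    exists v : 'cV[R]_n -> R,
      [/\ {within Omega, continuous v},
          forall x, Omega x -> 0 < v x &
          viscosity_supersolution F Omega lam v]]].

Definition inf_laplacian_H (R : realType) (n : nat) : operator R n :=
  fun _ q Y => (enorm q ^+ 2)^-1 * (q^T *m Y *m q) ord0 ord0.

(* Main.v *)
Require Import Defs.
From HB Require Import structures.
From mathcomp Require Import all_boot all_order all_algebra.
From mathcomp Require Import all_classical all_reals all_analysis.
From mathcomp Require Import ring lra.
Import Order.TTheory GRing.Theory Num.Theory.
Import numFieldNormedType.Exports.
Local Open Scope classical_set_scope.
Local Open Scope ring_scope.

(** Write [d(x)] for the Euclidean distance from [x] to the complement of
    [Omega], so that [r] is the maximum of [d], and set [kappa = pi / (2 r)].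
    Both inequalities come from comparison with one-dimensional sines and
    cosines, for frequencies [k] that approach [kappa] from one side.

    Lower bound.  For [0 < k < kappa] the function [v = sin (k d)] is a positive
    supersolution with eigenvalue [k ^ 2] (sin_edist_supersolution).  Let [psi]
    touch [v] from below at [x], let [y0] be a point of the complement nearest
    to [x] and [z = x - y0].  Since [d <= |. - y0|], the function
    [sin (k |. - y0|)] also touches [psi] from above at [x].  This forces the
    gradient of [psi] at [x] to be a positive multiple of [z], and the second
    derivative of [psi] at [x] along the unit direction of [z] to be at most
    [- k ^ 2 psi(x)].  Because [k r < pi / 2] strictly, the gradient does not
    vanish, so the envelope is bounded by the value of the operator, once the
    Hessian is known to be symmetric (partial_comm).

    Upper bound.  Let [d(x0) = r], let [v] be a positive supersolution for [lam]
    and let [k > kappa], so that the closed ball of radius [pi / (2 k)] around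
    [x0] lies in [Omega].  The quotient of [cos (k |x - x0|)] by [v] attains its
    maximum over this ball at an interior point [x1], where a multiple of
    [cos (k |x - x0|)] touches [v] from below.  Near [x1] this multiple is
    replaced by a polynomial in [|x - x0| ^ 2] that lies below it and has almost
    the same second radial derivative (cos_quadratic_minorant); a polynomial is
    smooth also when [x1 = x0].  A term [- e |x - x1| ^ 2] makes the contact
    strict.  The envelope is bounded from below in lsc_envelope_radial, and the supersolution property gives [lam <= k ^ 2]
    (supersolution_le_sqr). *)

(** * One-variable and directional calculus *)

Lemma is_derive_line {R : realType} {V : normedModType R} (f : V -> R)
    (y v : V) (t df : R) :
  is_derive (y + t *: v) v f df -> is_derive t 1 (fun s => f (y + s *: v)) df.
Proof.
move=> [fd fv].
have E : (fun h : R => h^-1 *: (((fun s => f (y + s *: v)) \o shift t) (h *: 1)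
            - f (y + t *: v)))
  = (fun h : R => h^-1 *: ((f \o shift (y + t *: v)) (h *: v) - f (y + t *: v))).
  apply/funext => h /=; congr (_ *: (f _ - _)).
  by rewrite [h *: 1]mulr1 scalerDl addrCA.
by split; rewrite /derivable /derive E.
Qed.

Lemma is_derive_translate {R : realType} {V : normedModType R} (f : V -> R)
    (y c v : V) (df : R) :
  is_derive (y + c) v f df -> is_derive y v (fun z => f (z + c)) df.
Proof.
move=> [fd fv].
have E : (fun h : R => h^-1 *: (((fun z => f (z + c)) \o shift y) (h *: v)
            - f (y + c)))
  = (fun h : R => h^-1 *: ((f \o shift (y + c)) (h *: v) - f (y + c))).
  by apply/funext => h /=; rewrite addrA.
by split; rewrite /derivable /derive E.
Qed.

Lemma is_derive_cvg {R : realType} {V : normedModType R} (f : V -> R)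
    (x v : V) (d : R) :
  is_derive x v f d <-> h^-1 * (f (h *: v + x) - f x) @[h --> (0:R)^'] --> d.
Proof.
split => [[fd <-]|H]; first exact: fd.
by split; [apply/cvg_ex; exists d|apply: cvg_lim].
Qed.

Lemma near_max_derive0 {R : realType} (f : R -> R) (c d : R) :
  is_derive c 1 f d -> (\forall t \near c, f t <= f c) -> d = 0.
Proof.
move=> /is_derive_cvg fd fc.
have fc' : \forall h \near (0:R)^', f (h *: 1 + c) <= f c.
  apply: cvg_within.
  have : (fun h : R => h *: 1 + c) @ 0 --> 0 *: 1 + c.
    by apply: cvgD; [apply: cvgZr_tmp; exact: cvg_id|exact: cvg_cst].
  by rewrite scale0r add0r => /(_ _ fc).
apply/eqP; rewrite eq_le !leNgt; apply/andP; split; apply/negP => d0.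
- have H : \forall h \near (0:R)^', 0 < h^-1 * (f (h *: 1 + c) - f c).
    exact: (cvgr_gt d fd 0 d0).
  have : \forall h \near (0:R)^', h < 0.
    near=> h; rewrite ltNge; apply/negP => h0.
    have : 0 < h^-1 * (f (h *: 1 + c) - f c) by near: h.
    by rewrite ltNge mulr_ge0_le0 ?invr_ge0 // subr_le0; near: h.
  move=> /nbhs_ballP [e /= e0] /(_ (e / 2)); rewrite /ball /= sub0r normrN.
  by rewrite gtr0_norm ?divr_gt0 // gt_eqF ?divr_gt0// => H1; have := H1 _ isT; lra.
- have H : \forall h \near (0:R)^', 0 > h^-1 * (f (h *: 1 + c) - f c).
    exact: (cvgr_lt d fd 0 d0).
  have : \forall h \near (0:R)^', h > 0.
    near=> h; rewrite ltNge; apply/negP => h0.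
    have : 0 > h^-1 * (f (h *: 1 + c) - f c) by near: h.
    by rewrite ltNge mulr_le0 ?invr_le0 // subr_le0; near: h.
  move=> /nbhs_ballP [e /= e0] /(_ (- (e / 2))); rewrite /ball /= sub0r opprK.
  rewrite gtr0_norm ?divr_gt0 // oppr_eq0 gt_eqF ?divr_gt0// => H1.
  by have := H1 _ isT; lra.
Unshelve. all: by end_near. Qed.

(** Strict version at a critical point: only the derivative of [dh] at [c] is
    needed, not its continuity. *)
Lemma second_derivative_test {R : realType} (h dh : R -> R) (c d2 : R) :
  (\forall t \near c, is_derive t (1:R) h (dh t)) ->
  dh c = 0 -> is_derive c 1 dh d2 -> 0 < d2 ->
  \forall t \near c^', h c < h t.
Proof.
move=> hd dhc /is_derive_cvg dhd d20.
(* The derivative [dh] has the sign of [t - c] near [c]. *)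
have : \forall s \near (0:R)^', 0 < s^-1 * (dh (s *: 1 + c) - dh c).
  exact: (cvgr_gt d2 dhd 0 d20).
move=> /nbhs_ballP [e1 /= e10 P1].
move: hd => /nbhs_ballP [e2 /= e20 P2].
have D (t : R) : `|c - t| < Num.min e1 e2 -> is_derive t (1:R) h (dh t).
  by move=> ct; apply: P2; rewrite /ball /=; move: ct; rewrite lt_min => /andP[].
have S (t : R) : `|c - t| < Num.min e1 e2 -> t != c -> 0 < (t - c) * dh t.
  rewrite lt_min => /andP[ct _] tc.
  have := P1 (t - c); rewrite /ball /= sub0r normrN distrC => /(_ ct).
  rewrite subr_eq0 => /(_ tc); rewrite [_ *: 1]mulr1 subrK dhc subr0.
  set u := t - c; have u0 : u != 0 by rewrite subr_eq0.
  move=> H; have -> : u * dh t = u^-1 * dh t * u ^+ 2 by field.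
  by rewrite mulr_gt0 // exprn_even_gt0.
have C (t : R) : `|c - t| < Num.min e1 e2 -> {for t, continuous h}.
  move=> /D [ht _]; apply: differentiable_continuous; exact/derivable1_diffP.
apply/nbhs_ballP; exists (Num.min e1 e2); first by rewrite /= lt_min e10.
move=> t; rewrite /ball /= => ct tc.
have [ltc|lct|E] := ltgtP t c; last by rewrite E eqxx in tc.
- have B (u : R) : t <= u <= c -> `|c - u| < Num.min e1 e2.
    move=> /andP[tu uc]; apply: le_lt_trans ct; rewrite !ger0_norm; lra.
  have [x|x|s] := @MVT R h dh t c ltc.
  + by rewrite in_itv /= => /andP[tx xc]; apply/D/B; lra.
  + apply: continuous_in_subspaceT => u.
    by rewrite inE /= in_itv /= => tuc; apply/C/B.
  rewrite in_itv /= => /andP[ts sc] E.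
  have Bs : `|c - s| < Num.min e1 e2 by apply: B; lra.
  have := S s Bs; rewrite lt_eqF // => /(_ isT) => H.
  have : 0 > dh s by nra.
  have : 0 < c - t by lra.
  nra.
- have B (u : R) : c <= u <= t -> `|c - u| < Num.min e1 e2.
    move=> /andP[tu uc]; apply: le_lt_trans ct; rewrite !ler0_norm; lra.
  have [x|x|s] := @MVT R h dh c t lct.
  + by rewrite in_itv /= => /andP[tx xc]; apply/D/B; lra.
  + apply: continuous_in_subspaceT => u.
    by rewrite inE /= in_itv /= => tuc; apply/C/B.
  rewrite in_itv /= => /andP[ts sc] E.
  have Bs : `|c - s| < Num.min e1 e2 by apply: B; lra.
  have := S s Bs; rewrite gt_eqF // => /(_ isT) => H.
  have : 0 < dh s by nra.
  have : 0 < t - c by lra.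
  nra.
Qed.

(** Mean value theorem along a coordinate axis; [a] may have either sign. *)
Lemma mvt_coord {R : realType} {n : nat} (f : 'cV[R]_n -> R) (y : 'cV[R]_n)
    (i : 'I_n) (a : R) :
  (forall s, `|s| <= `|a| -> derivable f (y + s *: ebasis R i) (ebasis R i)) ->
  exists2 s, `|s| <= `|a| &
    f (y + a *: ebasis R i) - f y = a * partial i f (y + s *: ebasis R i).
Proof.
move=> fd.
pose g (s : R) := f (y + s *: ebasis R i).
pose dg (s : R) := partial i f (y + s *: ebasis R i).
have gd (s : R) : `|s| <= `|a| -> is_derive s (1:R) g (dg s).
  by move=> sa; apply/is_derive_line/derivableP/fd.
have gc (s : R) : `|s| <= `|a| -> {for s, continuous g}.
  by move=> /gd [H _]; apply/differentiable_continuous/derivable1_diffP.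
have g0 : g 0 = f y by rewrite /g scale0r addr0.
have [a0|a0] := leP 0 a.
- have B (s : R) : 0 <= s <= a -> `|s| <= `|a|.
    by move=> /andP[s0 sa]; rewrite !ger0_norm.
  have [s|s|s] := @MVT_segment R g dg 0 a a0.
  + by rewrite in_itv /= => /andP[s0 sa]; apply/gd/B; rewrite !ltW.
  + apply: continuous_in_subspaceT => u.
    by rewrite inE /= in_itv /= => su; exact/gc/B.
  rewrite in_itv /= => /B sa E; exists s => //.
  by move: E; rewrite g0 subr0 mulrC.
- have B (s : R) : a <= s <= 0 -> `|s| <= `|a|.
    by move=> /andP[s0 sa]; rewrite (ler0_norm sa) (ltr0_norm a0) lerN2.
  have [s|s|s] := @MVT_segment R g dg a 0 (ltW a0).
  + by rewrite in_itv /= => /andP[s0 sa]; apply/gd/B; rewrite !ltW.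
  + apply: continuous_in_subspaceT => u.
    by rewrite inE /= in_itv /= => su; exact/gc/B.
  rewrite in_itv /= => /B sa E; exists s => //.
  move: E; rewrite g0 sub0r mulrN => /eqP; rewrite -eqr_oppLR opprB => /eqP.
  by rewrite mulrC.
Qed.

Lemma norm_ebasis {R : realType} {n : nat} (i : 'I_n) : `|ebasis R i| <= 1.
Proof.
rewrite /Num.norm /= mx_normrE; apply/bigmax_leP; split => // -[j k] _ /=.
by rewrite mxE; case: (_ && _); rewrite ?normr0 ?normr1.
Qed.

(** A function with continuous first-order partial derivatives has all its
    directional derivatives, given by the gradient. *)
Lemma is_derive_C1 {R : realType} {n : nat} (f : 'cV[R]_n -> R)
    (x v : 'cV[R]_n) :
  (\forall y \near x, forall i, derivable f y (ebasis R i)) ->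
  (forall i, {for x, continuous (partial i f)}) ->
  is_derive x v f (\sum_(i < n) v i ord0 * partial i f x).
Proof.
move=> fd fc; apply/is_derive_cvg.
(* Go from [x] to [x + h v] one coordinate at a time: [w k] keeps the first
   [k] coordinates of [v]. *)
pose w (k : nat) : 'cV[R]_n := \col_i (if (i < k)%N then v i ord0 else 0).
have w0 : w 0%N = 0 by apply/colP => i; rewrite !mxE.
have wn : w n = v by apply/colP => i; rewrite !mxE ltn_ord.
have wS (k : 'I_n) : w k.+1 = w k + v k ord0 *: ebasis R k.
  apply/colP => i; rewrite !mxE eqxx andbT.
  have [->|ik] := eqVneq i k; first by rewrite ltnn ltnS leqnn mulr1 add0r.
  by rewrite mulr0 addr0 ltnS leq_eqVlt (inj_eq val_inj) (negPf ik).
have E (h : R) : h^-1 * (f (h *: v + x) - f x) =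
    \sum_(k < n) h^-1 * (f (x + h *: w k.+1) - f (x + h *: w k)).
  rewrite -mulr_sumr -(big_mkord xpredT
    (fun k => f (x + h *: w k.+1) - f (x + h *: w k))) telescope_sumr //.
  by rewrite w0 wn scaler0 addr0 [_ + x]addrC.
under eq_cvg do rewrite E.
apply: (@cvg_big _ _ _ _ _ (fun p => add_continuous p)) => k _.
apply/cvgrPdist_le => e e0.
have e1 : 0 < e / (`|v k ord0| + 1) by rewrite divr_gt0 // ltr_wpDl.
have : \forall y \near x, (forall i, derivable f y (ebasis R i)) /\
    `|partial k f x - partial k f y| <= e / (`|v k ord0| + 1).
  apply: filterI => //; have /cvgrPdist_le/(_ _ e1) := fc k; exact.
move=> /nbhs_ballP [d /= d0 P].
have W0 : 0 < `|w k| + `|v k ord0| + 1 by rewrite ltr_wpDl // addr_ge0.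
near=> h.
have hd : `|h| * (`|w k| + `|v k ord0| + 1) < d.
  by rewrite -ltr_pdivlMr //; near: h; apply: dnbhs0_lt; rewrite divr_gt0.
have h0 : h != 0 by near: h; exact: nbhs_dnbhs_neq.
have B (s : R) : `|s| <= `|h * v k ord0| ->
    ball x d (x + h *: w k + s *: ebasis R k).
  move=> sh; rewrite -ball_normE /ball_ /= -addrA opprD addNKr normrN.
  apply: le_lt_trans (ler_normD _ _) _; rewrite !normrZ.
  have : `|s| * `|ebasis R k| <= `|h| * `|v k ord0|.
    by rewrite -normrM -[leRHS]mulr1 ler_pM ?norm_ebasis.
  by have := normr_ge0 h; nra.
have [s sh E1] := @mvt_coord R n f (x + h *: w k) k (h * v k ord0)
  (fun s hs => (P _ (B s hs)).1 k).
rewrite wS scalerDr addrA scalerA E1 mulrA mulrA mulVf // mul1r -mulrBr normrM.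
have := (P _ (B s sh)).2; set D := `|_ - _| => HD.
have : `|v k ord0| * D <= `|v k ord0| * (e / (`|v k ord0| + 1)).
  by rewrite ler_wpM2l.
move=> /le_trans; apply; rewrite mulrCA ger_pMr // ler_pdivrMr ?mul1r ?lerDl //.
Unshelve. all: by end_near. Qed.

(** The left-hand side is symmetric in [i] and [j]; this is what makes mixed
    partial derivatives commute. *)
Lemma second_difference {R : realType} {n : nat} (f : 'cV[R]_n -> R)
    (x : 'cV[R]_n) (i j : 'I_n) (s : R) :
  (forall a b, `|a| <= `|s| -> `|b| <= `|s| ->
    derivable f (x + a *: ebasis R i + b *: ebasis R j) (ebasis R i) /\
    derivable (partial i f) (x + a *: ebasis R i + b *: ebasis R j)
      (ebasis R j)) ->
  exists a b, [/\ `|a| <= `|s|, `|b| <= `|s| &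
    f (x + s *: ebasis R i + s *: ebasis R j) - f (x + s *: ebasis R i)
      - f (x + s *: ebasis R j) + f x
    = s ^+ 2 * partial j (partial i f)
               (x + a *: ebasis R i + b *: ebasis R j)].
Proof.
move=> H.
pose g y := f (y + s *: ebasis R j) - f y.
have gd (a : R) : `|a| <= `|s| -> is_derive (x + a *: ebasis R i) (ebasis R i) g
    (partial i f (x + a *: ebasis R i + s *: ebasis R j)
     - partial i f (x + a *: ebasis R i)).
  move=> sa; apply: is_deriveB.
    apply/is_derive_translate/derivableP; exact: (H a s sa (lexx _)).1.
  have s0 : `|0 : R| <= `|s| by rewrite normr0.
  by apply/derivableP; have := (H a 0 sa s0).1; rewrite scale0r addr0; exact.
have [a sa Ea] := @mvt_coord R n g x i s (fun a ha => @ex_derive _ _ _ _ _ _ _ (gd a ha)).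
have [b sb Eb] := @mvt_coord R n (partial i f) (x + a *: ebasis R i) j s
  (fun b hb => (H a b sa hb).2).
exists a, b; split => //.
have Eg : partial i g (x + a *: ebasis R i) = _ :=
  @derive_val _ _ _ _ _ _ _ (gd a sa).
move: Ea; rewrite Eg Eb /g.
by rewrite mulrA -expr2 => <-; ring.
Qed.

(** Schwarz's theorem. *)
Lemma partial_comm {R : realType} {n : nat} (f : 'cV[R]_n -> R)
    (x : 'cV[R]_n) (i j : 'I_n) :
  (\forall y \near x, forall i, derivable f y (ebasis R i)) ->
  (\forall y \near x, forall i j,
     derivable (partial j f) y (ebasis R i)) ->
  (forall i j, {for x, continuous (partial i (partial j f))}) ->
  partial i (partial j f) x = partial j (partial i f) x.
Proof.
move=> fd fdd fc; apply/eqP; rewrite -subr_eq0 -normr_le0.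
apply/ler_addgt0Pr => e e0; rewrite add0r.
have e2 : 0 < e / 2 by rewrite divr_gt0.
have : \forall y \near x, [/\ forall i, derivable f y (ebasis R i),
    forall i j, derivable (partial j f) y (ebasis R i),
    `|partial i (partial j f) x - partial i (partial j f) y| <= e / 2 &
    `|partial j (partial i f) x - partial j (partial i f) y| <= e / 2].
  have /cvgrPdist_le/(_ _ e2) c1 := fc i j.
  have /cvgrPdist_le/(_ _ e2) c2 := fc j i.
  apply: filterS (filterI (filterI fd fdd) (filterI c1 c2)) => y.
  by move=> [[h1 h2] [h3 h4]]; split; [exact: h1|exact: h2|exact: h3|exact: h4].
move=> /nbhs_ballP [d /= d0 P].
pose s := d / 3.
have s0 : 0 < s by rewrite divr_gt0.
have B (k l : 'I_n) (a b : R) : `|a| <= `|s| -> `|b| <= `|s| ->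
    ball x d (x + a *: ebasis R k + b *: ebasis R l).
  move=> ha hb; rewrite -ball_normE /ball_ /= -addrA opprD addNKr normrN.
  apply: le_lt_trans (ler_normD _ _) _; rewrite !normrZ.
  have M (c : R) (m : 'I_n) : `|c| <= `|s| -> `|c| * `|ebasis R m| <= s.
    by move=> hc; rewrite -[leRHS]mulr1 -(gtr0_norm s0) ler_pM ?norm_ebasis.
  by have := M a k ha; have := M b l hb; rewrite /s; lra.
have [a [b [ha hb Eab]]] : exists a b, [/\ `|a| <= `|s|, `|b| <= `|s| & _] :=
  @second_difference R n f x i j s (fun a b ha hb =>
   let: And4 h1 h2 _ _ := P _ (B i j a b ha hb) in conj (h1 i) (h2 j i)).
have [a' [b' [ha' hb' Eab']]] : exists a b, [/\ `|a| <= `|s|, `|b| <= `|s| & _] :=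
  @second_difference R n f x j i s (fun a b ha hb =>
   let: And4 h1 h2 _ _ := P _ (B j i a b ha hb) in conj (h1 j) (h2 i j)).
have [_ _ _ P1] := P _ (B i j a b ha hb).
have [_ _ P2 _] := P _ (B j i a' b' ha' hb').
have E : partial j (partial i f) (x + a *: ebasis R i + b *: ebasis R j) =
         partial i (partial j f) (x + a' *: ebasis R j + b' *: ebasis R i).
  apply: (@mulfI _ (s ^+ 2)); first by rewrite expf_neq0 // gt_eqF.
  apply: etrans (esym Eab) _; apply: etrans _ Eab'.
  rewrite (addrAC x (s *: ebasis R j)); congr (_ + _).
  exact: addrAC.
rewrite E in P1; rewrite (splitr e); apply: le_trans (lerD P2 P1).
by apply: le_trans (ler_normB _ _); rewrite opprB addrA subrK.
Qed.

(** * Euclidean geometry of column vectors *)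

(** The squared Euclidean norm. *)
Definition sqn {R : realType} {n : nat} (x : 'cV[R]_n) : R :=
  \sum_(i < n) x i ord0 ^+ 2.

(** The Euclidean inner product. *)
Definition dotp {R : realType} {n : nat} (x y : 'cV[R]_n) : R :=
  \sum_(i < n) x i ord0 * y i ord0.

Lemma dotpp {R : realType} {n : nat} (x : 'cV[R]_n) : dotp x x = sqn x.
Proof. by apply: eq_bigr => i _; rewrite expr2. Qed.

Lemma sqn_ge0 {R : realType} {n : nat} (x : 'cV[R]_n) : 0 <= sqn x.
Proof. by apply: sumr_ge0 => i _; exact: sqr_ge0. Qed.

Lemma enorm_ge0 {R : realType} {n : nat} (x : 'cV[R]_n) : 0 <= enorm x.
Proof. exact: sqrtr_ge0. Qed.

Lemma sqr_enorm {R : realType} {n : nat} (x : 'cV[R]_n) : enorm x ^+ 2 = sqn x.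
Proof. by rewrite sqr_sqrtr ?sqn_ge0. Qed.

Lemma sqn0_eq0 {R : realType} {n : nat} (x : 'cV[R]_n) : sqn x = 0 -> x = 0.
Proof.
move=> /eqP; rewrite psumr_eq0 => [/allP H|i _]; last exact: sqr_ge0.
apply/colP => i; rewrite mxE; apply/eqP.
by have := H i (mem_index_enum _); rewrite sqrf_eq0.
Qed.

Lemma sqn_gt0 {R : realType} {n : nat} (x : 'cV[R]_n) : x != 0 -> 0 < sqn x.
Proof.
move=> x0; rewrite lt_neqAle sqn_ge0 andbT eq_sym.
by apply: contra x0 => /eqP/sqn0_eq0 ->.
Qed.

Lemma enorm_gt0 {R : realType} {n : nat} (x : 'cV[R]_n) :
  x != 0 -> 0 < enorm x.
Proof. by move=> /sqn_gt0 H; rewrite sqrtr_gt0. Qed.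

Lemma enorm0 {R : realType} {n : nat} : enorm (0 : 'cV[R]_n) = 0.
Proof.
rewrite /enorm big1 ?sqrtr0 // => i _; by rewrite mxE expr0n.
Qed.

Lemma sqnZ {R : realType} {n : nat} (a : R) (x : 'cV[R]_n) :
  sqn (a *: x) = a ^+ 2 * sqn x.
Proof. by rewrite mulr_sumr; apply: eq_bigr => i _; rewrite mxE exprMn. Qed.

Lemma enormZ {R : realType} {n : nat} (a : R) (x : 'cV[R]_n) :
  enorm (a *: x) = `|a| * enorm x.
Proof.
by rewrite /enorm -!/(sqn _) sqnZ sqrtrM ?sqr_ge0 // sqrtr_sqr.
Qed.

Lemma enormB_sym {R : realType} {n : nat} (x y : 'cV[R]_n) :
  enorm (x - y) = enorm (y - x).
Proof. by rewrite -(opprB y x) -scaleN1r enormZ normrN normr1 mul1r. Qed.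

Lemma sqnD {R : realType} {n : nat} (x y : 'cV[R]_n) :
  sqn (x + y) = sqn x + 2 * dotp x y + sqn y.
Proof.
rewrite mulr_sumr -!big_split /=; apply: eq_bigr => i _.
by rewrite mxE sqrrD mulr_natl.
Qed.

Lemma dotpZr {R : realType} {n : nat} (a : R) (x y : 'cV[R]_n) :
  dotp x (a *: y) = a * dotp x y.
Proof. by rewrite mulr_sumr; apply: eq_bigr => i _; rewrite mxE mulrCA. Qed.

Lemma dotpZl {R : realType} {n : nat} (a : R) (x y : 'cV[R]_n) :
  dotp (a *: x) y = a * dotp x y.
Proof. by rewrite mulr_sumr; apply: eq_bigr => i _; rewrite mxE mulrA. Qed.

Lemma dotp_ebasis {R : realType} {n : nat} (x : 'cV[R]_n) (i : 'I_n) :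
  dotp x (ebasis R i) = x i ord0.
Proof.
rewrite /dotp (bigD1 i) //= !mxE !eqxx mulr1 big1 ?addr0 // => j ji.
by rewrite !mxE (negPf ji) mulr0.
Qed.

(** The Cauchy-Schwarz inequality. *)
Lemma dotp_le {R : realType} {n : nat} (x y : 'cV[R]_n) :
  dotp x y <= enorm x * enorm y.
Proof.
have [->|x0] := eqVneq x 0.
  by rewrite enorm0 mul0r -(scale0r 0) dotpZl mul0r.
have [->|y0] := eqVneq y 0.
  by rewrite enorm0 mulr0 -(scale0r 0) dotpZr mul0r.
have [a0 b0] := (enorm_gt0 x x0, enorm_gt0 y y0).
(* Expand the square of [|y| x - |x| y]. *)
have := sqn_ge0 (enorm y *: x + (- enorm x) *: y).
rewrite sqnD dotpZr dotpZl !sqnZ -!sqr_enorm.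
set a := enorm x in a0 *; set b := enorm y in b0 *; set c := dotp x y.
have ab : 0 < a * b by rewrite mulr_gt0.
have -> : b ^+ 2 * a ^+ 2 + 2 * (- a * (b * c)) + (- a) ^+ 2 * b ^+ 2 =
          2 * ((a * b) * (a * b - c)) by ring.
by rewrite pmulr_rge0 // pmulr_rge0 // subr_ge0.
Qed.

Lemma enormD {R : realType} {n : nat} (x y : 'cV[R]_n) :
  enorm (x + y) <= enorm x + enorm y.
Proof.
rewrite -(@ler_pXn2r _ 2) ?nnegrE ?addr_ge0 ?enorm_ge0 //.
rewrite sqr_enorm sqnD sqrrD -!sqr_enorm mulr_natl lerD2r lerD2l.
by rewrite lerMn2r /= dotp_le.
Qed.

Lemma norm_le_enorm {R : realType} {n : nat} (x : 'cV[R]_n) : `|x| <= enorm x.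
Proof.
rewrite /Num.norm /= mx_normrE; apply/bigmax_leP; split => [|[i j] _ /=].
  exact: enorm_ge0.
rewrite (ord1 j) -sqrtr_sqr ler_sqrt ?sqn_ge0 //.
rewrite (bigD1 i) //= lerDl; apply: sumr_ge0 => k _; exact: sqr_ge0.
Qed.

Lemma sum_continuous_at {R : realType} {T : topologicalType} {n : nat}
    (F : 'I_n -> T -> R) (x : T) :
  (forall i, {for x, continuous (F i)}) ->
  {for x, continuous (fun y => \sum_(i < n) F i y)}.
Proof.
move=> Fc; apply: (@cvg_big _ _ _ _ _ (fun p => add_continuous p) T (nbhs x)).
by move=> i _; exact: Fc.
Qed.

Lemma sqn_continuous {R : realType} {n : nat} : continuous (@sqn R n).
Proof.
move=> x; apply: sum_continuous_at => i.
by apply: (@continuous_comp _ _ _ (fun y : 'cV[R]_n => y i ord0) (fun t => t ^+ 2));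
  [exact: coord_continuous|exact: exprn_continuous].
Qed.

Lemma enorm_continuous {R : realType} {n : nat} : continuous (@enorm R n).
Proof.
move=> x; apply: (@continuous_comp _ _ _ (@sqn R n) Num.sqrt).
  exact: sqn_continuous.
exact: sqrt_continuous.
Qed.

Lemma enormB_continuous {R : realType} {n : nat} (c : 'cV[R]_n) :
  continuous (fun x : 'cV[R]_n => enorm (x - c)).
Proof.
move=> x; apply: (@continuous_comp _ _ _ (fun y : 'cV[R]_n => y - c) (@enorm R n)).
  apply: (@continuousB R 'cV[R]_n 'cV[R]_n (fun y => y) (fun=> c)).
    exact: cvg_id.
  exact: cst_continuous.
exact: enorm_continuous.
Qed.

Lemma compact_closed_ebounded {R : realType} {n : nat} (A : set 'cV[R]_n)
    (c : 'cV[R]_n) (M : R) :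
  closed A -> (forall x, A x -> enorm (x - c) <= M) -> compact A.
Proof.
move=> Acl AM.
(* Transfer the Heine-Borel property from row vectors by transposition. *)
have trc (m k : nat) : continuous (@trmx R m k).
  move=> x B /nbhs_ballP [e /= e0 eB]; apply/nbhs_ballP; exists e => //= y.
  by move=> [_ H]; apply: eB; split => // i j; rewrite !mxE; exact: H.
pose B : set 'rV[R]_n := [set x | A x^T].
have cB : compact B.
  apply: bounded_closed_compact.
    exists (M + `|c|); split; first exact: num_real.
    move=> K MK x Bx; apply: le_trans (ltW MK).
    have : `|x^T| <= M + `|c|.
      rewrite -[x^T](subrK c); apply: le_trans (ler_normD _ _) _.
      by rewrite lerD2r; apply: le_trans (norm_le_enorm _) (AM _ Bx).
    apply: le_trans; rewrite /Num.norm /= !mx_normrE.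
    apply/bigmax_leP; split; first by apply/bigmax_geP; left.
    move=> [i j] _ /=; apply/bigmax_geP; right.
    by exists (j, i) => //=; rewrite mxE.
  by apply: closed_comp => // x _; exact: trc.
have -> : A = trmx @` B.
  apply/seteqP; split => [x Ax|_ [x Bx <-] //].
  by exists x^T; rewrite /B /= trmxK.
by apply: continuous_compact => //; apply: continuous_subspaceT => x; exact: trc.
Qed.

Lemma compact_closed_eball {R : realType} {n : nat} (c : 'cV[R]_n) (r : R) :
  compact [set x | enorm (x - c) <= r].
Proof.
apply: (@compact_closed_ebounded _ _ _ c r) => //.
apply: (@closed_comp _ _ (fun x : 'cV[R]_n => enorm (x - c)) [set t | t <= r]).
  by move=> x _; exact: enormB_continuous.
exact: closed_le.
Qed.

(** * The Euclidean distance to a set *)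

Lemma edist_to_le {R : realType} {n : nat} (x y : 'cV[R]_n) (A : set 'cV[R]_n) :
  A y -> edist_to x A <= enorm (x - y).
Proof.
move=> Ay; apply: ge_inf; last by exists y.
by exists 0 => _ [z _ <-]; exact: enorm_ge0.
Qed.

Lemma edist_to_ge0 {R : realType} {n : nat} (x : 'cV[R]_n) (A : set 'cV[R]_n) :
  A !=set0 -> 0 <= edist_to x A.
Proof.
move=> [a Aa]; apply: lb_le_inf; first by exists (enorm (x - a)), a.
by move=> _ [y _ <-]; exact: enorm_ge0.
Qed.

Lemma edist_to_attained {R : realType} {n : nat} (x : 'cV[R]_n)
    (A : set 'cV[R]_n) : closed A -> A !=set0 ->
  exists2 y, A y & edist_to x A = enorm (x - y).
Proof.
move=> Acl [a Aa].
pose B := A `&` [set y | enorm (y - x) <= enorm (a - x)].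
have Bcl : closed B.
  apply: closedI => //.
  apply: (@closed_comp _ _ (fun y : 'cV[R]_n => enorm (y - x)) [set t | t <= _]).
    by move=> y _; exact: enormB_continuous.
  exact: closed_le.
have cB : compact B by apply: compact_closed_ebounded Bcl _ => y [_]; exact.
have B0 : B !=set0 by exists a; split => /=.
have cf : {within B, continuous (fun y : 'cV[R]_n => enorm (x - y))}.
  apply: continuous_subspaceT => y.
  rewrite (_ : (fun y : 'cV[R]_n => enorm (x - y)) = (fun y => enorm (y - x))).
    exact: enormB_continuous.
  by apply/funext => z; exact: enormB_sym.
have [y] := compact_EVT_min B0 cB cf.
rewrite inE => -[Ay _] ymin; exists y => //.
apply/eqP; rewrite eq_le edist_to_le //=.
apply: lb_le_inf; first by exists (enorm (x - a)), a.
move=> _ [z Az <-].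
have [za|/ltW za] := leP (enorm (z - x)) (enorm (a - x)).
  by apply: ymin; rewrite inE.
apply: le_trans (ymin a _) _; first by rewrite inE; split => /=.
by rewrite enormB_sym (enormB_sym x).
Qed.

Lemma edist_to_lipschitz {R : realType} {n : nat} (A : set 'cV[R]_n)
    (x z : 'cV[R]_n) : closed A -> A !=set0 ->
  edist_to x A <= edist_to z A + enorm (x - z).
Proof.
move=> Acl A0; have [y Ay ->] := edist_to_attained z A Acl A0.
apply: le_trans (edist_to_le x y A Ay) _.
have -> : x - y = (x - z) + (z - y) by rewrite addrA subrK.
by rewrite [leRHS]addrC enormD.
Qed.

Lemma edist_to_continuous {R : realType} {n : nat} (A : set 'cV[R]_n) :
  closed A -> A !=set0 -> continuous (fun x : 'cV[R]_n => edist_to x A).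
Proof.
move=> Acl A0 x.
apply/(@cvgrPdist_le _ _ _ (nbhs x) (nbhs_filter x)) => e e0.
have := @enormB_continuous R n x x; rewrite /continuous_at subrr enorm0.
move=> /(@cvgrPdist_le _ _ _ (nbhs x) (nbhs_filter x)) /(_ e e0).
apply: filterS => z; rewrite sub0r normrN ger0_norm ?enorm_ge0 // => ze.
have := edist_to_lipschitz A x z Acl A0.
have := edist_to_lipschitz A z x Acl A0.
by rewrite (enormB_sym x) ler_norml => H1 H2; apply/andP; split; lra.
Qed.

(** * The operator and its lower semicontinuous envelope *)

(** The quadratic form [q^T Y q], as a double sum. *)
Definition qform {R : realType} {n : nat} (Y : 'M[R]_n) (q : 'cV[R]_n) : R :=
  \sum_(i < n) \sum_(j < n) q i ord0 * q j ord0 * Y i j.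

Lemma inf_laplacian_HE {R : realType} {n : nat} (s : R) (q : 'cV[R]_n)
    (Y : 'M[R]_n) : inf_laplacian_H s q Y = (sqn q)^-1 * qform Y q.
Proof.
rewrite /inf_laplacian_H sqr_enorm; congr (_ * _).
rewrite mxE /qform exchange_big /=; apply: eq_bigr => i _.
rewrite mxE mulr_suml; apply: eq_bigr => j _.
by rewrite !mxE mulrAC.
Qed.

Lemma qformZ {R : realType} {n : nat} (Y : 'M[R]_n) (a : R) (q : 'cV[R]_n) :
  qform Y (a *: q) = a ^+ 2 * qform Y q.
Proof.
rewrite mulr_sumr; apply: eq_bigr => i _; rewrite mulr_sumr.
by apply: eq_bigr => j _; rewrite !mxE; ring.
Qed.

Lemma qformD {R : realType} {n : nat} (X Y : 'M[R]_n) (q : 'cV[R]_n) :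
  qform (X + Y) q = qform X q + qform Y q.
Proof.
rewrite -big_split /=; apply: eq_bigr => i _; rewrite -big_split /=.
by apply: eq_bigr => j _; rewrite !mxE mulrDr.
Qed.

Lemma qform_scalar {R : realType} {n : nat} (a : R) (q : 'cV[R]_n) :
  qform a%:M q = a * sqn q.
Proof.
rewrite mulr_sumr; apply: eq_bigr => i _.
rewrite (bigD1 i) //= big1 => [|j ji]; last first.
  by rewrite mxE eq_sym (negPf ji) mulr0n mulr0.
by rewrite addr0 mxE eqxx mulr1n mulrC expr2.
Qed.

Lemma qform_rank1 {R : realType} {n : nat} (a : R) (z q : 'cV[R]_n) :
  qform (a *: (z *m z^T)) q = a * dotp q z ^+ 2.
Proof.
rewrite expr2 /dotp big_distrlr mulr_sumr; apply: eq_bigr => i _.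
rewrite mulr_sumr; apply: eq_bigr => j _.
by rewrite !mxE big_ord_recl big_ord0 !mxE /=; ring.
Qed.

Lemma qform_le_norm {R : realType} {n : nat} (E : 'M[R]_n) (q : 'cV[R]_n)
    (d : R) : (forall i j, `|E i j| <= d) -> `|qform E q| <= n%:R * d * sqn q.
Proof.
move=> Ed.
have -> : n%:R * d * sqn q = \sum_(i < n) \sum_(j < n)
    d / 2 * (q i ord0 ^+ 2 + q j ord0 ^+ 2).
  under eq_bigr do rewrite -mulr_sumr big_split /= sumr_const card_ord.
  rewrite -mulr_sumr big_split /= sumr_const card_ord sumrMnl -/(sqn q).
  by rewrite -mulr_natl; field.
apply: le_trans (ler_norm_sum _ _ _) _; apply: ler_sum => i _.
apply: le_trans (ler_norm_sum _ _ _) _; apply: ler_sum => j _.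
rewrite !normrM -(real_normK (num_real (q i ord0))).
rewrite -(real_normK (num_real (q j ord0))).
have := Ed i j; have := normr_ge0 (E i j); have := normr_ge0 (q i ord0).
have := normr_ge0 (q j ord0).
set a := `|q i ord0|; set b := `|q j ord0|; set c := `|E i j| => b0 a0 c0 cd.
have H1 : a * b * c <= a * b * d by rewrite ler_wpM2l // mulr_ge0.
have H2 : 0 <= d * (a - b) ^+ 2 by rewrite mulr_ge0 ?sqr_ge0 // (le_trans c0).
nra.
Qed.

Lemma lsc_envelope_ge {R : realType} {n : nat} (F : operator R n) (s : R)
    (q : 'cV[R]_n) (Y : 'M[R]_n) (m : R) :
  (\forall z \near (s, q, Y), z.1.2 != 0 -> m <= F z.1.1 z.1.2 z.2) ->
  (m%:E <= lsc_envelope F s q Y)%E.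
Proof.
move=> H; rewrite /lsc_envelope limf_einfE.
apply: le_ereal_sup_tmp.
exists (ereal_inf ((fun z : R * 'cV[R]_n * 'M[R]_n => (F z.1.1 z.1.2 z.2)%:E) @`
   [set z : R * 'cV[R]_n * 'M[R]_n | m <= F z.1.1 z.1.2 z.2])).
  exists [set z : R * 'cV[R]_n * 'M[R]_n | m <= F z.1.1 z.1.2 z.2] => //.
  by rewrite /within /=; apply: filterS H => z H [z0 _]; exact: H.
by apply: le_ereal_inf_tmp => _ [z mz <-]; rewrite lee_fin.
Qed.

(** The point [(s, q, Y)] itself takes part in the lower limit as soon as it is
    in the domain of the operator. *)
Lemma lsc_envelope_le {R : realType} {n : nat} (F : operator R n) (s : R)
    (q : 'cV[R]_n) (Y : 'M[R]_n) :
  q != 0 -> Y^T = Y -> (lsc_envelope F s q Y <= (F s q Y)%:E)%E.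
Proof.
move=> q0 YT; rewrite /lsc_envelope limf_einfE.
apply: ge_ereal_sup => _ [V HV <-]; apply: ereal_inf_lbound.
exists (s, q, Y) => //=.
by have := nbhs_singleton HV; apply; split.
Qed.

Lemma inf_laplacian_H_continuous {R : realType} {n : nat} (s : R)
    (q : 'cV[R]_n) (Y : 'M[R]_n) : q != 0 ->
  {for (s, q, Y), continuous (fun z : R * 'cV[R]_n * 'M[R]_n =>
     inf_laplacian_H z.1.1 z.1.2 z.2)}.
Proof.
move=> q0.
have -> : (fun z : R * 'cV[R]_n * 'M[R]_n => inf_laplacian_H z.1.1 z.1.2 z.2)
   = (fun z => (sqn z.1.2)^-1 * qform z.2 z.1.2).
  by apply/funext => z; rewrite inf_laplacian_HE.
have c2 : {for (s, q, Y), continuous (fun z : R * 'cV[R]_n * 'M[R]_n => z.1.2)}.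
  apply: (@continuous_comp _ _ _ fst snd).
    exact: cvg_fst.
  exact: cvg_snd.
have ci i : {for (s, q, Y), continuous
    (fun z : R * 'cV[R]_n * 'M[R]_n => z.1.2 i ord0)}.
  apply: (@continuous_comp _ _ _ (fun z : R * 'cV[R]_n * 'M[R]_n => z.1.2)
    (fun p : 'cV[R]_n => p i ord0)) => //.
  exact: coord_continuous.
apply: (@continuousM _ _ (fun z : R * 'cV[R]_n * 'M[R]_n => (sqn z.1.2)^-1)
   (fun z : R * 'cV[R]_n * 'M[R]_n => qform z.2 z.1.2)).
  apply: continuousV; first by rewrite /= gt_eqF // sqn_gt0.
  apply: (@continuous_comp _ _ _ (fun z : R * 'cV[R]_n * 'M[R]_n => z.1.2)
    (@sqn R n)) => //.
  exact: sqn_continuous.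
apply: sum_continuous_at => i; apply: sum_continuous_at => j.
apply: (@continuousM _ _ (fun z : R * 'cV[R]_n * 'M[R]_n =>
    z.1.2 i ord0 * z.1.2 j ord0)
   (fun z : R * 'cV[R]_n * 'M[R]_n => z.2 i j)).
  by apply: continuousM; exact: ci.
apply: (@continuous_comp _ _ _ snd (fun p : 'M[R]_n => p i j)).
  exact: cvg_snd.
exact: coord_continuous.
Qed.

(** For a radial test function [x |-> A |x|^2 + B (|x|^2 - |z|^2)^2 - e |x - z|^2],
    whose gradient and Hessian at [z] are the arguments below, the envelope of
    the operator is at least the second radial derivative, up to [3 e]. *)
Lemma lsc_envelope_radial {R : realType} {n : nat} (s A B e : R)
    (z : 'cV[R]_n) : 0 < e -> (z != 0 -> A != 0) ->
  ((2 * A + 8 * B * sqn z - 3 * e)%:E <=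
   lsc_envelope (@inf_laplacian_H R n) s ((2 * A) *: z)
     ((2 * A - 2 * e)%:M + (8 * B) *: (z *m z^T)))%E.
Proof.
move=> e0 zA; apply: lsc_envelope_ge.
have [z0|z0] := eqVneq z 0.
  (* Zero gradient: bound the Rayleigh quotient of a small perturbation of a
     scalar matrix. *)
  rewrite z0 scaler0 mul0mx scaler0 addr0.
  have -> : sqn (0 : 'cV[R]_n) = 0 by rewrite -sqr_enorm enorm0 expr0n.
  rewrite mulr0 addr0; set Y := _%:M.
  have d0 : 0 < e / (n%:R + 1) by rewrite divr_gt0 // ltr_wpDl.
  have H : \forall z \near (s, 0 : 'cV[R]_n, Y), ball Y (e / (n%:R + 1)) z.2.
    by apply: cvg_snd; exact: nbhsx_ballx.
  apply: filterS H => -[[t p] X] /= [_ H] p0.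
  rewrite inf_laplacian_HE [leRHS]mulrC ler_pdivlMr ?sqn_gt0 //.
  rewrite -[X in qform X](subrK Y) qformD qform_scalar.
  have : `|qform (X - Y) p| <= n%:R * (e / (n%:R + 1)) * sqn p.
    apply: qform_le_norm => i j; rewrite !mxE distrC.
    by have := H i j; rewrite /ball /= !mxE => /ltW.
  have : n%:R * (e / (n%:R + 1)) <= e.
    by rewrite mulrCA ger_pMr // ler_pdivrMr ?mul1r ?lerDl // ltr_wpDl.
  have := sqn_gt0 p p0; rewrite ler_norml.
  set N := n%:R * _; set S := sqn p => S0 Ne /andP[H1 _].
  have : N * S <= e * S by rewrite ler_pM2r.
  by set NS := N * S in H1 *; nra.
(* Nonzero gradient: the operator is continuous there. *)
have [{}zA S0] := (zA z0, sqn_gt0 z z0).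
have q0 : (2 * A) *: z != 0 by rewrite scaler_eq0 (negPf z0) orbF mulf_neq0.
have := @inf_laplacian_H_continuous R n s _
  ((2 * A - 2 * e)%:M + (8 * B) *: (z *m z^T)) q0.
set Y := _ + _ *: _ => cF.
have E : inf_laplacian_H s ((2 * A) *: z) Y =
    2 * A + 8 * B * sqn z - 2 * e.
  rewrite inf_laplacian_HE qformZ sqnZ qformD qform_scalar qform_rank1 dotpp.
  by field; rewrite gt_eqF.
move: cF => /cvgrPdist_le /(_ e e0); apply: filterS => -[[t p] X] H _.
have {}H : `|inf_laplacian_H s ((2 * A) *: z) Y - inf_laplacian_H t p X| <= e.
  exact: H.
by move: H; rewrite E [(t, p, X).2]/= ler_norml => /andP[_]; lra.
Qed.

(** A polynomial of degree at most two in [rho ^ 2] that touches [cos (k rho)]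
    from below at [rho1], with a second derivative there that is smaller by
    [e]. *)
Lemma cos_quadratic_minorant {R : realType} (k rho1 e : R) :
  0 < k -> 0 <= rho1 -> k * rho1 < pi / 2 -> 0 < e ->
  exists A B, [/\ rho1 != 0 -> A != 0,
    2 * A + 8 * B * rho1 ^+ 2 = - k ^+ 2 * cos (k * rho1) - e &
    \forall rho \near rho1,
      A * (rho ^+ 2 - rho1 ^+ 2) + B * (rho ^+ 2 - rho1 ^+ 2) ^+ 2
      <= cos (k * rho) - cos (k * rho1)].
Proof.
move=> k0 rho0 rhok e0.
(* These equations say that the difference [h] below has vanishing first
   derivative and second derivative [e] at [rho1]. *)
have [A [B [A0 HA HAB]]] : exists A B, [/\ rho1 != 0 -> A != 0,
    2 * A * rho1 = - k * sin (k * rho1) &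
    2 * A + 8 * B * rho1 ^+ 2 = - k ^+ 2 * cos (k * rho1) - e].
  have [r0|r0] := eqVneq rho1 0.
    exists (- (k ^+ 2 + e) / 2), 0; rewrite r0 !mulr0 sin0 cos0.
    by split => //; field.
  have rp : 0 < rho1 by rewrite lt_neqAle eq_sym r0.
  have s0 : 0 < sin (k * rho1) by apply: sin_gt0_pihalf; rewrite mulr_gt0.
  pose A := - k * sin (k * rho1) / (2 * rho1).
  exists A, ((- k ^+ 2 * cos (k * rho1) - e - 2 * A) / (8 * rho1 ^+ 2)).
  split=> [_||]; rewrite /A; [|by field|by field].
  by rewrite !mulf_neq0 ?oppr_eq0 ?invr_eq0 ?mulf_neq0 // ?gt_eqF.
exists A, B; split => //.
pose h (t : R) : R := cos (k * t) - cos (k * rho1) - A * (t ^+ 2 - rho1 ^+ 2)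
   - B * (t ^+ 2 - rho1 ^+ 2) ^+ 2.
pose dh (t : R) : R := - k * sin (k * t) - 2 * A * t
  - 4 * B * t * (t ^+ 2 - rho1 ^+ 2).
have dkt (t : R) : is_derive t 1 (fun t : R => k * t) k.
  by apply: is_derive_eq; rewrite /GRing.scale /= ?mulr1 ?mulr0 ?addr0.
have dsq (t : R) : is_derive t 1 (fun t : R => t ^+ 2 - rho1 ^+ 2) (2 * t).
  by apply: is_derive_eq; rewrite /GRing.scale /=; ring.
have dcos (t : R) : is_derive t 1 (fun t => cos (k * t)) (- sin (k * t) * k).
  exact: (@is_derive1_comp _ cos (fun t => k * t)).
have dsin (t : R) : is_derive t 1 (fun t => sin (k * t)) (cos (k * t) * k).
  exact: (@is_derive1_comp _ sin (fun t => k * t)).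
have dhh (t : R) : is_derive t 1 h (dh t).
  apply: is_derive_eq; rewrite /GRing.scale /dh /=; ring.
have dh0 : dh rho1 = 0 by rewrite /dh subrr mulr0 subr0 HA subrr.
have ddh : is_derive rho1 (1:R) dh e.
  apply: is_derive_eq; rewrite /GRing.scale /=.
  rewrite (_ : e = - k ^+ 2 * cos (k * rho1) - 2 * A - 8 * B * rho1 ^+ 2).
    by ring.
  by lra.
have dhn : \forall t \near rho1, is_derive t (1:R) h (dh t).
  by near=> t; exact: dhh.
have := second_derivative_test h dh rho1 e dhn dh0 ddh e0.
rewrite near_withinE; apply: filterS => t H.
have [->|t1] := eqVneq t rho1; first by rewrite !subrr expr0n !mulr0 addr0.
by have := H t1; rewrite /h !subrr expr0n /= !mulr0; lra.
Unshelve. all: by end_near.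
Qed.

(** * Radial test functions *)

(** A function that is quadratic along the line through [x] in direction
    [v]. *)
Lemma is_derive_quadratic {R : realType} {n : nat} (f : 'cV[R]_n -> R)
    (x v : 'cV[R]_n) (a b : R) :
  (forall h, f (h *: v + x) = f x + h * a + h ^+ 2 * b) -> is_derive x v f a.
Proof.
move=> fE; apply/is_derive_cvg.
have H : (fun h : R => a + h * b) @ (0:R)^' --> a.
  have : {for 0, continuous (fun h : R => a + h * b)}.
    by apply: continuousD; [exact: cst_continuous|exact: mulrr_continuous].
  move=> H; have {}H : a + h * b @[h --> (0:R)] --> a + 0 * b := H.
  by rewrite mul0r addr0 in H; exact: cvg_within_filter.
apply: cvg_trans H; apply: near_eq_cvg; near=> h.
have h0 : h != 0 by near: h; exact: nbhs_dnbhs_neq.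
by rewrite fE; field.
Unshelve. all: by end_near. Qed.

#[local] Instance is_derive_sqnB {R : realType} {n : nat} (c x v : 'cV[R]_n) :
  is_derive x v (fun y => sqn (y - c)) (2 * dotp (x - c) v).
Proof.
apply: (@is_derive_quadratic _ _ _ _ _ _ (sqn v)) => h.
by rewrite -addrA addrC sqnD dotpZr sqnZ; ring.
Qed.

#[local] Instance is_derive_coordB {R : realType} {n : nat} (c x v : 'cV[R]_n)
    (i : 'I_n) :
  is_derive x v (fun y => (y - c) i ord0) (v i ord0).
Proof.
apply: (@is_derive_quadratic _ _ _ _ _ _ 0) => h; rewrite !mxE; ring.
Qed.

Lemma sqnB_continuous {R : realType} {n : nat} (c : 'cV[R]_n) :
  continuous (fun x : 'cV[R]_n => sqn (x - c)).
Proof.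
move=> x; apply: (@continuous_comp _ _ _ (fun y : 'cV[R]_n => y - c) (@sqn R n)).
  apply: (@continuousB R 'cV[R]_n 'cV[R]_n (fun y => y) (fun=> c)).
    exact: cvg_id.
  exact: cst_continuous.
exact: sqn_continuous.
Qed.

Lemma coordB_continuous {R : realType} {n : nat} (c : 'cV[R]_n) (i : 'I_n) :
  continuous (fun x : 'cV[R]_n => (x - c) i ord0).
Proof.
move=> x; apply: (@continuous_comp _ _ _ (fun y : 'cV[R]_n => y - c)
  (fun y : 'cV[R]_n => y i ord0)).
  apply: (@continuousB R 'cV[R]_n 'cV[R]_n (fun y => y) (fun=> c)).
    exact: cvg_id.
  exact: cst_continuous.
exact: coord_continuous.
Qed.

(** A polynomial of degree at most two in [|x - c|^2], penalised by [e |x - x1|^2] so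
    that contact at [x1] becomes strict. *)
Definition radial_test {R : realType} {n : nat} (c x1 : 'cV[R]_n)
    (C A B e : R) (x : 'cV[R]_n) : R :=
  C + A * (sqn (x - c) - sqn (x1 - c)) + B * (sqn (x - c) - sqn (x1 - c)) ^+ 2
  - e * sqn (x - x1).

Section RadialTest.
Context {R : realType} {n : nat} (c x1 : 'cV[R]_n) (C A B e : R).
Let Q := radial_test c x1 C A B e.
(* The first and second partial derivatives of [Q]. *)
Let D (i : 'I_n) (x : 'cV[R]_n) : R :=
  2 * A * (x - c) i ord0
  + 4 * B * (sqn (x - c) - sqn (x1 - c)) * (x - c) i ord0
  - 2 * e * (x - x1) i ord0.
Let DD (i j : 'I_n) (x : 'cV[R]_n) : R :=
  (i == j)%:R * (2 * A + 4 * B * (sqn (x - c) - sqn (x1 - c)) - 2 * e)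
  + 8 * B * ((x - c) i ord0 * (x - c) j ord0).

Let is_derive_test (i : 'I_n) (x : 'cV[R]_n) :
  is_derive x (ebasis R i) Q (D i x).
Proof.
rewrite /Q /radial_test; apply: is_derive_eq.
rewrite !dotp_ebasis /GRing.scale /D /=; ring.
Qed.

Let is_derive_D (i j : 'I_n) (x : 'cV[R]_n) :
  is_derive x (ebasis R i) (D j) (DD i j x).
Proof.
rewrite /D; apply: is_derive_eq.
rewrite !dotp_ebasis /GRing.scale /DD !mxE eqxx andbT eq_sym /=.
case: (i == j) => /=; ring.
Qed.

Let partialQ (i : 'I_n) : partial i Q = D i.
Proof.
by apply/funext => x; exact: (@derive_val _ _ _ _ _ _ _ (is_derive_test i x)).
Qed.

Let partialD (i j : 'I_n) : partial i (D j) = DD i j.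
Proof.
by apply/funext => x; exact: (@derive_val _ _ _ _ _ _ _ (is_derive_D i j x)).
Qed.

Lemma grad_radial_test : grad Q x1 = (2 * A) *: (x1 - c).
Proof.
apply/colP => i; rewrite mxE partialQ /D !subrr !mxE; ring.
Qed.

Lemma hessian_radial_test : hessian Q x1 =
  (2 * A - 2 * e)%:M + (8 * B) *: ((x1 - c) *m (x1 - c)^T).
Proof.
apply/matrixP => i j; rewrite mxE partialQ partialD /DD.
rewrite subrr mulr0 addr0 !mxE big_ord_recl big_ord0 !mxE /= addr0.
by case: (i == j) => /=; ring.
Qed.

Lemma C2_radial_test : C2_on setT Q.
Proof.
have cS := @sqnB_continuous R n c; have cT := @sqnB_continuous R n x1.
have cx (i : 'I_n) := @coordB_continuous R n c i.
have cx1 (i : 'I_n) := @coordB_continuous R n x1 i.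
have cc (a : R) (x : 'cV[R]_n) : {for x, continuous (fun _ : 'cV[R]_n => a)}.
  exact: cst_continuous.
have cSB (x : 'cV[R]_n) : {for x, continuous (fun y : 'cV[R]_n =>
    sqn (y - c) - sqn (x1 - c))} by apply: continuousB => //; exact: cS.
move=> x _; split.
- rewrite /Q /radial_test; apply: continuousB; last first.
    by apply: continuousM => //; exact: cT.
  apply: continuousD; last first.
    apply: continuousM => //.
    apply: (@continuous_comp _ _ _ (fun y : 'cV[R]_n => sqn (y - c) - sqn (x1 - c))
      (fun t => t ^+ 2)); [exact: cSB|exact: exprn_continuous].
  by apply: continuousD => //; apply: continuousM.
- by move=> i; exact: (@ex_derive _ _ _ _ _ _ _ (is_derive_test i x)).
- move=> i; rewrite partialQ /D; apply: continuousB; last first.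
    by apply: continuousM => //; exact: cx1.
  apply: continuousD; first by apply: continuousM => //; exact: cx.
  apply: continuousM; last exact: cx.
  by apply: continuousM.
- by move=> i j; rewrite partialQ; exact: (@ex_derive _ _ _ _ _ _ _ (is_derive_D i j x)).
- move=> i j; rewrite partialQ partialD /DD; apply: continuousD; last first.
    apply: continuousM => //; apply: continuousM; exact: cx.
  apply: continuousM => //; apply: continuousB => //.
  apply: continuousD => //; exact: continuousM.
Qed.

End RadialTest.

(** * Upper bound for the eigenvalue *)

(** A positive supersolution around the closed ball of radius [pi / (2 k)] has
    eigenvalue at most [k ^ 2]. *)
Lemma supersolution_le_sqr {R : realType} {n : nat} (Omega : set 'cV[R]_n)
    (lam k : R) (v : 'cV[R]_n -> R) (x0 : 'cV[R]_n) :
  {within Omega, continuous v} -> (forall x, Omega x -> 0 < v x) ->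
  viscosity_supersolution (@inf_laplacian_H R n) Omega lam v ->
  0 < k -> (forall x, enorm (x - x0) <= pi / (2 * k) -> Omega x) ->
  lam <= k ^+ 2.
Proof.
move=> vc v0 vs k0 BO.
pose B := [set x : 'cV[R]_n | enorm (x - x0) <= pi / (2 * k)].
have cB : compact B by exact: compact_closed_eball.
have Bx0 : B x0 by rewrite /B /= subrr enorm0 divr_ge0 ?pi_ge0 // mulr_ge0 // ltW.
pose u (x : 'cV[R]_n) : R := cos (k * enorm (x - x0)).
pose w (x : 'cV[R]_n) : R := u x / v x.
have uc : continuous u.
  move=> x; apply: (@continuous_comp _ _ _ (fun x : 'cV[R]_n => k * enorm (x - x0))
    (@cos R)); last exact: continuous_cos.
  apply: continuousM; first exact: cst_continuous.
  exact: enormB_continuous.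
have wc : {within B, continuous w}.
  have vcB : {within B, continuous v} by apply: continuous_subspaceW vc => x; exact: BO.
  rewrite continuous_subspace_in => x xB; apply: cvgM.
    exact: (continuous_subspaceT uc).
  apply: cvgV; last exact: vcB.
  by rewrite gt_eqF // v0 //; apply: BO; move: xB; rewrite inE.
have [x1] := compact_EVT_max (ex_intro _ x0 Bx0) cB wc.
rewrite inE => Bx1 wmax.
have vx1 : 0 < v x1 by apply/v0/BO.
have w1 : 0 < w x1.
  apply: lt_le_trans (wmax x0 _); last by rewrite inE.
  by rewrite /w /u subrr enorm0 mulr0 cos0 divr_gt0 // v0 //; exact: BO.
have u1 : 0 < u x1 by move: w1; rewrite /w pmulr_lgt0 // invr_gt0.
(* The maximum is interior, as [u] vanishes on the boundary of the ball. *)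
pose rho1 := enorm (x1 - x0).
have rho1_lt : rho1 < pi / (2 * k).
  rewrite lt_neqAle; apply/andP; split; last exact: Bx1.
  apply/negP => /eqP E; move: u1; rewrite /u -/rho1 E.
  rewrite (_ : k * _ = pi / 2); first by rewrite cos_pihalf ltxx.
  by field; rewrite gt_eqF.
have krho1 : k * rho1 < pi / 2.
  have -> : pi / 2 = k * (pi / (2 * k)) by field; rewrite gt_eqF.
  by rewrite ltr_pM2l.
(* The largest multiple of [u] below [v] on the ball touches [v] at [x1]. *)
pose t := v x1 / u x1.
have t0 : 0 < t by rewrite divr_gt0.
have tu : t * u x1 = v x1 by rewrite /t divfK // gt_eqF.
have tv x : B x -> t * u x <= v x.
  move=> Bx; have := wmax x (mem_set Bx).
  rewrite /w ler_pdivrMr ?v0 //; last exact: BO.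
  by rewrite -(ler_pdivlMl _ _ t0) /t invf_div.
rewrite leNgt; apply/negP => lamk.
pose g := (lam - k ^+ 2) * v x1.
have g0 : 0 < g by rewrite mulr_gt0 // subr_gt0.
(* The two errors cost [t * (g / (4 * t)) + 3 * (g / 8)], which is less than
   the gap [g]. *)
have e10 : 0 < g / (4 * t) by rewrite divr_gt0 // mulr_gt0.
have e20 : 0 < g / 8 by rewrite divr_gt0.
have [A [C [A0 AC Hmin]]] :=
  cos_quadratic_minorant k rho1 _ k0 (enorm_ge0 _) krho1 e10.
pose psi := radial_test x0 x1 (v x1) (t * A) (t * C) (g / 8).
have psi1 : psi x1 = v x1.
  by rewrite /psi /radial_test !subrr -(sqr_enorm 0) enorm0 !expr0n /=; ring.
have touch : touches_from_below psi v x1.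
  split => //.
  have rc := @enormB_continuous R n x0 x1.
  have N1 : \forall y \near x1, A * (enorm (y - x0) ^+ 2 - rho1 ^+ 2)
      + C * (enorm (y - x0) ^+ 2 - rho1 ^+ 2) ^+ 2 <= u y - u x1.
    exact: (rc _ Hmin).
  have N2 : \forall y \near x1, enorm (y - x0) < pi / (2 * k).
    exact: (cvgr_lt _ rc).
  rewrite near_withinE; near=> y => yx1.
  have By : B y by rewrite /B /= ltW //; near: y.
  apply: lt_le_trans (tv y By).
  have : A * (enorm (y - x0) ^+ 2 - rho1 ^+ 2)
      + C * (enorm (y - x0) ^+ 2 - rho1 ^+ 2) ^+ 2 <= u y - u x1 by near: y.
  rewrite -(ler_pM2l t0) (mulrBr t (u y)) tu !sqr_enorm => H.
  have : 0 < g / 8 * sqn (y - x1) by rewrite mulr_gt0 // sqn_gt0 // subr_eq0.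
  by rewrite /psi /radial_test; lra.
have C2 : exists U : set 'cV[R]_n, [/\ open U, U x1 & C2_on U psi].
  by exists setT; split => //; [exact: openT|exact: C2_radial_test].
have := vs x1 psi (BO _ Bx1) C2 touch.
rewrite psi1 grad_radial_test hessian_radial_test => Hvs.
have tA0 : x1 - x0 != 0 -> t * A != 0.
  move=> xx; rewrite mulf_neq0 //; first by rewrite gt_eqF.
  by apply: A0; rewrite gt_eqF // enorm_gt0.
have := lsc_envelope_radial (v x1) (t * A) (t * C) _ (x1 - x0) e20 tA0.
set L := lsc_envelope _ _ _ _ in Hvs *.
move=> HL; have : ((2 * (t * A) + 8 * (t * C) * sqn (x1 - x0) - 3 * (g / 8)
    + lam * v x1)%:E <= 0)%E.
  by apply: le_trans Hvs; rewrite EFinD; apply: leeD2r.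
rewrite lee_fin -sqr_enorm -/rho1.
have -> : 2 * (t * A) + 8 * (t * C) * rho1 ^+ 2 =
    t * (2 * A + 8 * C * rho1 ^+ 2) by ring.
rewrite AC; have -> : t * (- k ^+ 2 * cos (k * rho1) - g / (4 * t)) =
    - k ^+ 2 * (t * u x1) - g / 4.
  by rewrite /u -/rho1; field; rewrite gt_eqF.
by rewrite tu; move: g0; rewrite /g; lra.
Unshelve. all: by end_near. Qed.

(** * The sine of the distance is a supersolution *)

Lemma near_line {R : realType} {n : nat} (x w : 'cV[R]_n) (P : set 'cV[R]_n) :
  (\forall y \near x, P y) -> \forall t \near (0:R), P (x + t *: w).
Proof.
move=> xP.
have c : {for (0:R), continuous (fun t : R => x + t *: w)}.
  apply: continuousD; first exact: cst_continuous.
  exact: scalel_continuous.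
have : nbhs (x + (0:R) *: w) P by rewrite scale0r addr0.
exact: c.
Qed.

Lemma sin_le_pihalf {R : realType} (a b : R) :
  0 <= a -> a <= b -> b <= pi / 2 -> sin a <= sin b.
Proof.
move=> a0; rewrite le_eqVlt => /predU1P[-> //|ab] b1.
have p0 : 0 < pi / 2 :> R by rewrite divr_gt0 ?pi_gt0.
rewrite ltW // ltr_sin // in_itv /=; apply/andP; split; lra.
Qed.

(** In this section [psi] is of class C2 near [x] and lies below
    [sin (k |. - y0|)], with equality at [x]. *)
Section DistanceTouching.
Context {R : realType} {n : nat} (k : R) (x y0 : 'cV[R]_n)
  (psi : 'cV[R]_n -> R) (U : set 'cV[R]_n).
Context (k0 : 0 < k) (xy0 : x - y0 != 0)
  (kd : k * enorm (x - y0) < pi / 2)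
  (Uo : open U) (Ux : U x) (psiC2 : C2_on U psi)
  (psix : psi x = sin (k * enorm (x - y0)))
  (psi_le : \forall y \near x, psi y <= sin (k * enorm (y - y0))).
Let z := x - y0.
Let d := enorm z.
Let c := k * cos (k * d) / d.

Let d0 : 0 < d. Proof. exact: enorm_gt0. Qed.

Let cos_gt0 : 0 < cos (k * d).
Proof.
apply: cos_gt0_pihalf; rewrite kd andbT.
apply: (@lt_le_trans _ _ 0); first by rewrite oppr_lt0 divr_gt0 ?pi_gt0.
by rewrite mulr_ge0 ?enorm_ge0 // ltW.
Qed.

Let c0 : 0 < c. Proof. by rewrite divr_gt0 // mulr_gt0. Qed.

Lemma grad_touching : grad psi x = c *: z.
Proof.
apply/colP => i; rewrite [LHS]mxE [RHS]mxE; apply/eqP; rewrite -subr_eq0; apply/eqP.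
pose w := ebasis R i.
have x0w : x + (0:R) *: w = x by rewrite scale0r addr0.
have d1 : is_derive (0:R) (1:R) (fun t : R => psi (x + t *: w)) (partial i psi x).
  apply: is_derive_line; rewrite x0w; apply: derivableP.
  by have [_ H _ _ _] := psiC2 x Ux; exact: H.
have d2 : is_derive (0:R) (1:R) (fun t : R => sqn (x + t *: w - y0)) (2 * z i ord0).
  rewrite -dotp_ebasis; apply: (is_derive_line (fun y => sqn (y - y0))).
  rewrite x0w.
  exact: is_derive_sqnB.
have d3 : is_derive (0:R) (1:R) (fun t : R => enorm (x + t *: w - y0))
    ((2 * d)^-1 * (2 * z i ord0)).
  apply: (@is_derive1_comp _ Num.sqrt (fun t : R => sqn (x + t *: w - y0))).
  rewrite x0w; apply: is_derive1_sqrt; exact: sqn_gt0.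
have d4 : is_derive (0:R) (1:R) (fun t : R => k * enorm (x + t *: w - y0))
    (k * ((2 * d)^-1 * (2 * z i ord0))).
  by apply: is_derive_eq; rewrite /GRing.scale /= ?mulr0 ?addr0.
have d5 : is_derive (0:R) (1:R) (fun t : R => sin (k * enorm (x + t *: w - y0)))
    (cos (k * d) * (k * ((2 * d)^-1 * (2 * z i ord0)))).
  apply: (@is_derive1_comp _ sin (fun t : R => k * enorm (x + t *: w - y0))).
  by rewrite x0w; exact: is_derive_sin.
have d6 := is_deriveB d1 d5.
have := near_max_derive0 _ _ _ d6; rewrite /c => H.
have -> : partial i psi x - k * cos (k * d) / d * z i ord0 =
    partial i psi x - cos (k * d) * (k * ((2 * d)^-1 * (2 * z i ord0))).
  by field; rewrite gt_eqF.
apply: H.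
have := near_line x w _ psi_le; apply: filterS => t H.
rewrite [leRHS](_ : _ = 0); last first.
  by rewrite /= -[LHS]/(psi (x + 0 *: w) - sin (k * enorm (x + 0 *: w - y0)))
    x0w psix subrr.
by rewrite -[leLHS]/(psi (x + t *: w) - sin (k * enorm (x + t *: w - y0)))
  subr_le0.
Qed.

Lemma hessian_sym_touching : (hessian psi x)^T = hessian psi x.
Proof.
apply/matrixP => i j; rewrite !mxE; apply: partial_comm.
- apply: filterS (open_nbhs_nbhs (conj Uo Ux)) => y Uy.
  by have [_ H _ _ _] := psiC2 y Uy.
- apply: filterS (open_nbhs_nbhs (conj Uo Ux)) => y Uy.
  by have [_ _ _ H _] := psiC2 y Uy.
- by have [_ _ _ _ H] := psiC2 x Ux.
Qed.

(** Compare [psi] with the sine along the line from [y0] through [x]. *)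
Lemma hessian_touching : qform (hessian psi x) z <= - (k * d) ^+ 2 * sin (k * d).
Proof.
(* At the parameter [t] the distance to [y0] is [(1 + t) * d]. *)
pose q (t : R) : R := psi (x + t *: z) - sin (k * d * (1 + t)).
pose dq (t : R) : R := \sum_(i < n) z i ord0 * partial i psi (x + t *: z)
   - k * d * cos (k * d * (1 + t)).
have UN : \forall y \near x, U y by exact: open_nbhs_nbhs.
have x0z : x + (0:R) *: z = x by rewrite scale0r addr0.
have dlin (t : R) : is_derive t (1:R) (fun t : R => k * d * (1 + t)) (k * d).
  by apply: is_derive_eq; rewrite /GRing.scale /=; ring.
have dq1 : \forall t \near (0:R), is_derive t (1:R) q (dq t).
  apply: filterS (near_line x z _ UN) => t Ut.
  apply: is_deriveB; last first.
    rewrite [X in is_derive _ _ _ X]mulrC.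
    exact: (@is_derive1_comp _ sin (fun t => k * d * (1 + t))).
  apply: is_derive_line; apply: is_derive_C1.
    apply: filterS (open_nbhs_nbhs (conj Uo Ut)) => y Uy.
    by have [_ H _ _ _] := psiC2 y Uy.
  by have [_ _ H _ _] := psiC2 _ Ut.
have dq0 : dq 0 = 0.
  rewrite /dq x0z addr0 mulr1.
  have E i : partial i psi x = c * z i ord0.
    by have /colP/(_ i) := grad_touching; rewrite [LHS]mxE [RHS]mxE.
  under eq_bigr do rewrite E mulrCA -expr2.
  rewrite -mulr_sumr -/(sqn z) -sqr_enorm -/d /c; field; rewrite gt_eqF //.
pose h2 := \sum_(i < n) z i ord0 * (\sum_(j < n) z j ord0 * partial j (partial i psi) x).
have h2E : h2 = qform (hessian psi x) z.
  rewrite /h2 /qform exchange_big /=; apply: eq_bigr => i _.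
  by rewrite mulr_sumr; apply: eq_bigr => j _; rewrite [hessian _ _ _ _]mxE; ring.
have dq2 : is_derive (0:R) (1:R) dq (h2 + (k * d) ^+ 2 * sin (k * d)).
  have H i : is_derive (0:R) (1:R) (fun t : R => partial i psi (x + t *: z))
      (\sum_(j < n) z j ord0 * partial j (partial i psi) x).
    apply: is_derive_line; rewrite x0z; apply: is_derive_C1.
      apply: filterS UN => y Uy.
      by have [_ _ _ H _] := psiC2 y Uy => j; exact: H.
    by have [_ _ _ _ H] := psiC2 x Ux => j; exact: H.
  have dc : is_derive (0:R) (1:R) (fun t : R => cos (k * d * (1 + t)))
      (- sin (k * d * (1 + 0)) * (k * d)).
    exact: (@is_derive1_comp _ cos (fun t => k * d * (1 + t))).
  have dS : is_derive (0:R) (1:R)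
      (\sum_(i < n) (fun t : R => z i ord0 * partial i psi (x + t *: z))) h2.
    exact: is_derive_sum.
  have -> : dq = (\sum_(i < n) (fun t : R => z i ord0 * partial i psi (x + t *: z)))
      - (fun t : R => k * d * cos (k * d * (1 + t))).
    by apply/funext => t; rewrite /dq -[RHS]/(_ t - _ t) fct_sumE.
  have dk : is_derive (0:R) (1:R) (fun t : R => k * d * cos (k * d * (1 + t)))
      (- (k * d) ^+ 2 * sin (k * d)).
    apply: is_derive_eq; rewrite /GRing.scale /= addr0 mulr1; ring.
  by apply: is_derive_eq; rewrite mulNr opprK.
rewrite leNgt; apply/negP => pos.
have pos' : 0 < h2 + (k * d) ^+ 2 * sin (k * d).
  by rewrite h2E; lra.
have H1 := second_derivative_test q dq 0 _ dq1 dq0 dq2 pos'.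
have H2 : \forall t \near (0:R), q t <= q 0.
  have t1 : \forall t \near (0:R), -1 < t by apply: lt_nbhsr; rewrite oppr_lt0.
  apply: filterS (filterI t1 (near_line x z _ psi_le)) => t [t1' H].
  rewrite [leRHS](_ : _ = 0); last first.
    by rewrite /q x0z addr0 mulr1 psix subrr.
  rewrite /q subr_le0; apply: le_trans H _.
  have -> : x + t *: z - y0 = (1 + t) *: z by rewrite scalerDl scale1r addrAC.
  by rewrite enormZ ger0_norm -/d; [rewrite mulrCA mulrC|lra].
have H2' : \forall t \near (0:R)^', q t <= q 0 by exact: cvg_within.
have H3 : \forall t \near (0:R)^', False.
  by apply: filterS2 H1 H2' => t; rewrite ltNge => /negP.
by have [] := filter_ex H3.
Qed.

Lemma lsc_envelope_touching :
  (lsc_envelope (@inf_laplacian_H R n) (psi x) (grad psi x) (hessian psi x)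
     + (k ^+ 2 * psi x)%:E <= 0)%E.
Proof.
have q0 : grad psi x != 0.
  by rewrite grad_touching scaler_eq0 negb_or gt_eqF.
have H := @lsc_envelope_le _ _ (@inf_laplacian_H R n) (psi x) _ _ q0
  hessian_sym_touching.
apply: le_trans (leeD2r _ H) _.
rewrite -EFinD lee_fin inf_laplacian_HE grad_touching sqnZ qformZ -sqr_enorm -/d.
have -> : (c ^+ 2 * d ^+ 2)^-1 * (c ^+ 2 * qform (hessian psi x) z) =
    qform (hessian psi x) z / d ^+ 2.
  by field; rewrite !gt_eqF.
rewrite psix -/z -/d -lerBrDr sub0r ler_pdivrMr ?exprn_gt0 //.
by apply: le_trans hessian_touching _; rewrite exprMn; lra.
Qed.

End DistanceTouching.

Lemma sin_edist_supersolution {R : realType} {n : nat} (Omega : set 'cV[R]_n)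
    (k : R) :
  open Omega -> (~` Omega) !=set0 -> 0 < k ->
  (forall x, Omega x -> k * edist_to x (~` Omega) < pi / 2) ->
  let v := fun x => sin (k * edist_to x (~` Omega)) in
  [/\ {within Omega, continuous v}, forall x, Omega x -> 0 < v x &
      viscosity_supersolution (@inf_laplacian_H R n) Omega (k ^+ 2) v].
Proof.
move=> Oo O0 k0 kd v.
have Ocl : closed (~` Omega) by exact: open_closedC.
have near_pt x : Omega x -> exists y, [/\ (~` Omega) y,
    edist_to x (~` Omega) = enorm (x - y) & x - y != 0].
  move=> Ox; have [y Oy E] := edist_to_attained x _ Ocl O0.
  by exists y; split => //; rewrite subr_eq0; apply/eqP => xy; apply: Oy; rewrite -xy.
split.
- apply: continuous_subspaceT => x.
  apply: (@continuous_comp _ _ _ (fun x : 'cV[R]_n => k * edist_to x (~` Omega))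
    (@sin R)); last exact: continuous_sin.
  apply: continuousM; first exact: cst_continuous.
  exact: edist_to_continuous.
- move=> x Ox; apply: sin_gt0_pihalf; rewrite kd // andbT.
  have [y [_ -> xy]] := near_pt x Ox.
  by rewrite mulr_gt0 // enorm_gt0.
move=> x psi Ox [U [Uo Ux psiC2]] [psix psi_lt].
have [y [Oy E xy]] := near_pt x Ox.
have kdy : k * enorm (x - y) < pi / 2 by rewrite -E kd.
apply: (@lsc_envelope_touching _ _ k x y psi U) => //.
  by rewrite psix /v E.
have N : \forall z \near x, k * enorm (z - y) < pi / 2.
  have c : {for x, continuous (fun z : 'cV[R]_n => k * enorm (z - y))}.
    by apply: continuousM; [exact: cst_continuous|exact: enormB_continuous].
  exact: (cvgr_lt _ c).
move: psi_lt; rewrite near_withinE => psi_lt.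
apply: filterS2 N psi_lt => z Nz psiz.
have [->|zx] := eqVneq z x; first by rewrite psix /v E.
apply: le_trans (ltW (psiz zx)) _; apply: sin_le_pihalf; last exact: ltW.
  by rewrite mulr_ge0 ?edist_to_ge0 // ltW.
by rewrite ler_pM2l // edist_to_le.
Qed.

(** * The principal eigenvalue *)

Theorem mainTheorem3 (R : realType) (n : nat) (Omega : set 'cV[R]_n) (r : R)
    (Omega_domain : is_domain Omega)
    (Omega_compl : (~` Omega) !=set0)
    (r_inradius : is_inradius Omega r) :
  lambda1 (@inf_laplacian_H R n) Omega = ((pi / (2 * r)) ^+ 2)%:E.
Proof.
have [[a Oa] Oo _] := Omega_domain.
have [[x0 _ x0r] rub] := r_inradius.
have Ocl : closed (~` Omega) by exact: open_closedC.
have dr x : Omega x -> edist_to x (~` Omega) <= r.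
  by move=> Ox; apply: rub; exists x => //; exact: subset_closure.
have r0 : 0 < r.
  apply: lt_le_trans (dr a Oa).
  have [y Oy ->] := edist_to_attained a _ Ocl Omega_compl.
  by apply: enorm_gt0; rewrite subr_eq0; apply/eqP => ay; apply: Oy; rewrite -ay.
pose kappa := pi / (2 * r).
have kappa0 : 0 < kappa by rewrite divr_gt0 ?pi_gt0 // mulr_gt0.
have rE : pi / (2 * kappa) = r.
  move: (pi_gt0 R); rewrite /kappa; move: (pi : R) => p p0.
  by field; rewrite !gt_eqF.
have kr : kappa * r = pi / 2 by rewrite /kappa; field; rewrite gt_eqF.
rewrite -/kappa; apply/eqP; rewrite eq_le; apply/andP; split.
- apply: ge_ereal_sup => _ [lam [v [vc v0 vs]] <-]; rewrite lee_fin leNgt.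
  apply/negP => lamk.
  (* A frequency [k > kappa] with [k ^ 2] halfway between [kappa ^ 2] and [lam]. *)
  pose M := (lam + kappa ^+ 2) / 2; pose k := Num.sqrt M.
  have kM : k ^+ 2 = M by rewrite sqr_sqrtr // /M; have := sqr_ge0 kappa; lra.
  have kk : kappa < k.
    by rewrite -(@ltr_pXn2r _ 2) ?nnegrE ?sqrtr_ge0 ?(ltW kappa0) // kM /M; lra.
  have k0 : 0 < k by apply: lt_trans kk.
  have : lam <= k ^+ 2.
    apply: (@supersolution_le_sqr _ _ Omega lam k v x0) => // x xk.
    apply: contrapT => Ox.
    have : r <= enorm (x0 - x) by rewrite -x0r; exact: edist_to_le.
    rewrite leNgt enormB_sym => /negP; apply; apply: le_lt_trans xk _.
    have [h1 h2] : 0 < 2 * k /\ 0 < 2 * kappa by split; lra.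
    rewrite -[ltRHS]rE ltr_pM2l ?pi_gt0 // ltf_pV2 ?posrE //.
    by rewrite ltr_pM2l.
  by rewrite kM /M; lra.
- apply/lee_subgt0Pr => e e0; rewrite -EFinB.
  (* The maximum with [kappa ^ 2 / 2] keeps the frequency positive. *)
  pose M := Num.max (kappa ^+ 2 - e) (kappa ^+ 2 / 2); pose k := Num.sqrt M.
  have kp : 0 < kappa ^+ 2 by rewrite exprn_gt0.
  have M0 : 0 < M by rewrite lt_max divr_gt0 ?orbT.
  have Mk : M < kappa ^+ 2 by rewrite gt_max; apply/andP; split; lra.
  have k0 : 0 < k by rewrite sqrtr_gt0.
  have kM : k ^+ 2 = M by rewrite sqr_sqrtr // ltW.
  have kk : k < kappa.
    by rewrite -(@ltr_pXn2r _ 2) ?nnegrE ?(ltW kappa0) ?(ltW k0) // kM.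
  apply: (@le_trans _ _ (k ^+ 2)%:E).
    by rewrite lee_fin kM le_max lexx.
  apply: ereal_sup_ubound; exists (k ^+ 2) => //.
  exists (fun x => sin (k * edist_to x (~` Omega))).
  apply: sin_edist_supersolution => // x Ox; rewrite -kr.
  apply: (@le_lt_trans _ _ (k * r)); first by rewrite ler_pM2l // dr.
  by rewrite ltr_pM2r.
Qed.
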